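(* Let $q$ be a prime power, let $m\geq 5$ be an odd integer, $h=\lfloor m/2\rfloor$, and let $\delta\in \left[q^{h+1}, q^{\lfloor(2m-1)/3\rfloor +1}\right)$ be an integer. Let $j=j_\delta$ be the integer such that $q^{h+j}\leq \delta<q^{h+j+1}$, let $\sum_{\ell=0}^{h+j}\delta_{\ell}q^{\ell}$ be the $q$-adic expansion of $\delta$ (digits $0\le\delta_\ell\le q-1$), and let $r=r_{\delta}$ be the smallest integer in $[-j+1,j]$ such that $\delta_{h+r}>0$. Put $$L=\sum_{\ell=0}^{h-j}\delta_\ell q^\ell,\qquad U=\sum_{\ell=h-r+1}^{h+j}\delta_{\ell}q^{\ell-(h-r+1)},\qquad \hat{\delta}= \sum_{\ell=h+r}^{h+j}\delta_{\ell}q^{\ell}+ U.$$ (i) If $q\nmid \delta$, then $$d_B(\mathcal{C}_{(q,m,\delta)})=\begin{cases}\delta, & \text{if } L>U,\\ \hat\delta+1, & \text{if } L\le U \text{ and } \delta_{h-r+1}\neq q-1,\\ \hat\delta+2, & \text{if } L\le U \text{ and } \delta_{h-r+1}=q-1.\end{cases}$$ (ii) If $q\mid \delta$, then $$d_B(\mathcal{C}_{(q,m,\delta)})=\begin{cases}\delta+1, & \text{if } L\ge U,\\ \hat\delta+1, & \text{if } L<U \text{ and } \delta_{h-r+1}\neq q-1,\\ \hat\delta+2, & \text{if } L<U \text{ and } \delta_{h-r+1}=q-1.\end{cases}$$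
   Context: Let $\alpha$ be a primitive element of $\mathbb{F}_{q^m}$, $n=q^m-1$, and for an integer $i$ let $m_i(x)$ be the minimal polynomial of $\alpha^i$ over $\mathbb{F}_q$. For an integer $2\le\delta\le n$, $\mathcal{C}_{(q,m,\delta)}$ is the (narrow-sense primitive BCH) cyclic code of length $n$ over $\mathbb{F}_q$, i.e. the ideal of $\mathbb{F}_q[x]/(x^n-1)$, generated by $\mathrm{lcm}(m_1(x),\ldots,m_{\delta-1}(x))$. Its Bose distance $d_B(\mathcal{C}_{(q,m,\delta)})$ is the largest integer $d$ (with $2\le d\le n$) such that $\mathcal{C}_{(q,m,\delta)}=\mathcal{C}_{(q,m,d)}$. *)

(* Defs.v *)
From HB Require Import structures.
From mathcomp Require Import all_boot all_order all_algebra all_field.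
From mathcomp Require Import qpoly.

Set Implicit Arguments.
Unset Strict Implicit.
Unset Printing Implicit Defensive.

Import Order.TTheory GRing.Theory Num.Theory.
Local Open Scope ring_scope.

(* The monic least common multiple. *)
Definition lcmp (R : fieldType) (p q : {poly R}) : {poly R} :=
  let r := (p * q) %/ gcdp p q in (lead_coef r)^-1 *: r.

Lemma dvdp_lcmp (R : fieldType) (p q d : {poly R}) : p != 0 -> q != 0 ->
  (lcmp p q %| d) = (p %| d) && (q %| d).
Proof.
move=> p0 q0; rewrite /lcmp.
have g0 : gcdp p q != 0 by rewrite gcdp_eq0 negb_and p0.
have r0 : p * q %/ gcdp p q != 0.
  by rewrite dvdp_div_eq0 ?mulf_neq0 // dvdp_mulr ?dvdp_gcdl.
rewrite dvdpZl ?invr_eq0 ?lead_coef_eq0 //.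
have gpq : gcdp p q %| p * q by rewrite dvdp_mulr ?dvdp_gcdl.
rewrite -(dvdp_mul2r _ _ g0) divpK //.
have -> : (p * q %| d * gcdp p q) = (p * q %| gcdp (d * p) (d * q)).
  by apply: eqp_dvdr; apply: mulp_gcdr.
by rewrite dvdp_gcd (mulrC p q) !dvdp_mul2r // mulrC dvdp_mul2r // andbC.
Qed.

Section Codes.

Variables (F : finFieldType) (K : fieldExtType F).

Lemma minPoly1_descent (x : K) :
  exists p : {poly F}, map_poly (in_alg K) p == minPoly 1 x.
Proof. by have /polyOver1P[p ->] := minPolyOver 1 x; exists p. Qed.

(* minPoly 1 x has its coefficients in the copy of F inside K; this is the
   same polynomial in {poly F}. *)
Definition minPolyF (x : K) : {poly F} := xchoose (minPoly1_descent x).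

Lemma minPolyFE (x : K) : map_poly (in_alg K) (minPolyF x) = minPoly 1 x.
Proof. exact/eqP/(xchooseP (minPoly1_descent x)). Qed.

Definition prim_length : nat := (#|F| ^ \dim {:K}).-1.

Definition bch_gen (alpha : K) (delta : nat) : {poly F} :=
  \big[@lcmp F/1]_(1 <= i < delta) minPolyF (alpha ^+ i).

(* The ambient ring is F[x]/(x^n - 1): as 1 <= prim_length, the modulus is
   monic and nonconstant, so {poly %/ _} is the actual quotient by it. *)
Definition bch_code (alpha : K) (delta : nat) :
    {set {poly %/ ('X^prim_length - 1 : {poly F})}} :=
  [set c * in_qpoly ('X^prim_length - 1) (bch_gen alpha delta) |
     c : {poly %/ ('X^prim_length - 1 : {poly F})}].

Definition bose_distance (alpha : K) (delta : nat) : nat :=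
  \max_(2 <= d < prim_length.+1 | bch_code alpha delta == bch_code alpha d) d.

End Codes.

(* Main.v *)
(* The codes for delta and d coincide exactly when alpha^1, ..., alpha^(delta-1)
   and alpha^1, ..., alpha^(d-1) meet the same Frobenius orbits, and multiplying
   an exponent by q rotates its m-digit base-q expansion.  Hence the Bose distance
   is the least coset leader D >= delta, i.e. the least D none of whose cyclic
   rotations is smaller.
   Write m = 2h+1, A = h+r and a = H q^A + L with L < q^(h-j+1).  A rotation of a
   can only be smaller than a if its h-j leading digits vanish, and then the
   shift by A is the most dangerous one: it gives L q^(m-A) + H.  Comparing top
   digits with a, this is smaller than a exactly when L <= U = a / q^(m-A) (for
   q not dividing a).  Since H, and hence U, do not change while only the low
   digits do, one just raises L until it exceeds U and is not divisible by q. *)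

Require Import Defs.
From HB Require Import structures.
From mathcomp Require Import all_boot all_order all_algebra all_field.
From mathcomp Require Import qpoly.
From mathcomp Require Import zify.
Set Implicit Arguments.
Unset Strict Implicit.
Unset Printing Implicit Defensive.

Import Order.TTheory GRing.Theory Num.Theory.

(** * Frobenius and conjugates over the ground field *)

Section Frobenius.
Local Open Scope ring_scope.
Variables (F : finFieldType) (K : fieldExtType F).
Implicit Types (x y : K) (p : {poly F}).

Lemma pchar_nat_card : [pchar K].-nat #|F|.
Proof.
have [p p_pr Fp] := finPcharP F.
rewrite (eq_pnat _ (pchar_lalg K)) (eq_pnat _ (pcharf_eq Fp)).
have -> : #|F| = (p ^ logn p #|F|)%N := card_pprimeChar Fp.
by rewrite pnatX pnat_id.
Qed.

Definition frob x := x ^+ #|F|.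

Fact frob_nmod_morphism : nmod_morphism frob.
Proof.
split=> [|x y]; rewrite /frob; last exact: exprDn_pchar pchar_nat_card.
by rewrite expr0n -leqn0 leqNgt (ltn_trans _ (finNzRing_gt1 F)).
Qed.

Fact frob_monoid_morphism : monoid_morphism frob.
Proof. by split=> [|x y]; rewrite /frob ?expr1n ?exprMn. Qed.

HB.instance Definition _ := GRing.isNmodMorphism.Build K K frob frob_nmod_morphism.
HB.instance Definition _ := GRing.isMonoidMorphism.Build K K frob frob_monoid_morphism.

(** ['X^#|F| - 'X] already splits into linear factors over [F], so it has no further roots in
    [K]. *)
Lemma frob_fixed x : (frob x == x) = (x \in 1%VS).
Proof.
apply/idP/idP => [fx | /vlineP[a ->]]; last first.
  by rewrite /frob exprZn expr1n expf_card.
have : root (map_poly (in_alg K) ('X^#|F| - 'X)) x.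
  by rewrite rmorphB /= map_polyXn map_polyX rootE !hornerE subr_eq0.
rewrite finField_genPoly rmorph_prod /= => /rootP.
rewrite horner_prod => /eqP; rewrite prodf_seq_eq0 => /hasP[a _ /=].
by rewrite map_polyXsubC !hornerE subr_eq0 => /eqP->; rewrite rpredZ ?mem1v.
Qed.

Lemma frob_iter k x : iter k frob x = x ^+ (#|F| ^ k).
Proof. by elim: k => [|k IH] /=; rewrite ?expn0 ?expr1 // IH /frob -exprM expnSr. Qed.

Lemma root_iter_frob p k x :
  root (map_poly (in_alg K) p) x -> root (map_poly (in_alg K) p) (x ^+ (#|F| ^ k)).
Proof.
rewrite -frob_iter; elim: k => //= k IH /IH.
set y := iter k frob x => /rootP py0; apply/rootP.
have -> : map_poly (in_alg K) p = map_poly frob (map_poly (in_alg K) p).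
  rewrite -map_poly_comp; apply: eq_map_poly => a /=.
  by apply/esym/eqP; rewrite frob_fixed rpredZ ?mem1v.
by rewrite horner_map py0 /= rmorph0.
Qed.

Lemma minPolyF_dvdp x p : (minPolyF x %| p) = root (map_poly (in_alg K) p) x.
Proof.
rewrite -(dvdp_map (in_alg K)) minPolyFE; apply/idP/idP => [d|].
  by move: (root_minPoly 1 x); rewrite !root_factor_theorem => /dvdp_trans->.
by apply: minPoly_dvdp; apply/polyOver1P; exists p.
Qed.

Lemma minPolyF_neq0 x : minPolyF x != 0.
Proof. by rewrite -(map_poly_eq0 (in_alg K)) minPolyFE monic_neq0 // monic_minPoly. Qed.

(** Frobenius permutes the factors of [P] cyclically, because [x] returns after [m] steps. So [P]
    has its coefficients in [F] and the minimal polynomial divides it, even if conjugates are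
    repeated. *)
Lemma root_minPolyF m x y : (0 < m)%N -> x ^+ (#|F| ^ m) = x ->
  root (map_poly (in_alg K) (minPolyF x)) y ->
  exists2 k, (k < m)%N & y = x ^+ (#|F| ^ k).
Proof.
case: m => // m _ xm; rewrite minPolyFE => xy0.
pose P := \prod_(k < m.+1) ('X - (iter k frob x)%:P).
have : minPoly 1 x %| P.
  apply: minPoly_dvdp; last first.
    by rewrite /P big_ord_recl rootM /= root_XsubC eqxx.
  apply/polyOverP => i; rewrite -frob_fixed -coef_map /=; apply/eqP.
  congr (_`_i); rewrite /P rmorph_prod /= big_ord_recr big_ord_recl /=.
  have fm : frob (iter m frob x) = x by rewrite -[LHS]/(iter m.+1 frob x) frob_iter.
  rewrite map_polyXsubC /= fm mulrC.
  rewrite (eq_bigr (fun k : 'I_m => 'X - (frob (iter (0 + k) frob x))%:P)) // => k _.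
  by rewrite map_polyXsubC.
move: xy0; rewrite root_factor_theorem => /dvdp_trans/[apply].
rewrite -root_factor_theorem => /rootP/eqP.
rewrite horner_prod prodf_seq_eq0 => /hasP[k _ /=].
by rewrite !hornerE subr_eq0 frob_iter => /eqP ->; exists k.
Qed.

End Frobenius.

(** * Rotations of base-q expansions and coset leaders *)

Section Rotation.
Variables (q m : nat).
Hypothesis q_gt1 : 1 < q.

(* [rotq t a] rotates the m-digit base-q expansion of a, bringing its t lowest
   digits to the front. *)
Definition rotq t a := (a %% q ^ t) * q ^ (m - t) + a %/ q ^ t.

Definition coset_leader a := forall t, t < m -> a <= rotq t a.

(** Splitting [a] at digit [t] produces a term with the factor q^m, which is 1 modulo q^m - 1;
    [rotqK] is the same computation with the other part. *)
Lemma rotqE t a : t <= m -> rotq t a = a * q ^ (m - t) %[mod (q ^ m).-1].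
Proof.
move=> tm; have qm : q ^ m = (q ^ m).-1.+1 by rewrite prednK // expn_gt0 ltnW.
have -> : a * q ^ (m - t) = a %/ q ^ t * (q ^ m).-1 + rotq t a; last by rewrite modnMDl.
rewrite {1}(divn_eq a (q ^ t)) mulnDl -mulnA -expnD subnKC // {1}qm /rotq; lia.
Qed.

Lemma rotqK t a : t <= m -> rotq t a * q ^ t = a %[mod (q ^ m).-1].
Proof.
move=> tm; have qm : q ^ m = (q ^ m).-1.+1 by rewrite prednK // expn_gt0 ltnW.
have -> : rotq t a * q ^ t = a %% q ^ t * (q ^ m).-1 + a; last by rewrite modnMDl.
rewrite {3}(divn_eq a (q ^ t)) /rotq mulnDl -mulnA -expnD subnK // {1}qm; lia.
Qed.

Lemma rotq_leq t a : t <= m -> a < q ^ m -> rotq t a <= (q ^ m).-1.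
Proof.
move=> tm am; have q0 k : 0 < q ^ k by rewrite expn_gt0 (ltnW q_gt1).
rewrite -ltnS prednK // /rotq -{2}(subnKC tm) expnD.
have := ltn_pmod a (q0 t); rewrite -(leq_pmul2r (q0 (m - t))); apply: leq_trans.
by rewrite mulSn addnC ltn_add2r ltn_divLR // -expnD subnK.
Qed.

Lemma rotq_gt0 t a : 0 < a -> 0 < rotq t a.
Proof.
move=> a0; rewrite lt0n addn_eq0 muln_eq0 expn_eq0 -[q == 0]leqn0 leqNgt.
rewrite (ltnW q_gt1) orbF; apply: contraL a0 => /andP[/eqP a1 /eqP a2].
by rewrite (divn_eq a (q ^ t)) a1 a2.
Qed.

(** Rotating [a] by [k] undoes the factor q^k, so it would give a rotation of [a] equal to
    [i < a]. *)
Lemma coset_leader_min a i k : coset_leader a -> 0 < i < a -> a < q ^ m ->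
  k < m -> a <> i * q ^ k %[mod (q ^ m).-1].
Proof.
move=> La /andP[i0 ia] am km ai.
have n0 : a <= (q ^ m).-1 by rewrite -ltnS prednK // (leq_trans _ am).
have Er : rotq k a = i %[mod (q ^ m).-1].
  rewrite rotqE ?(ltnW km) // -modnMml ai modnMml -mulnA -expnD subnKC ?(ltnW km) //.
  rewrite -[q ^ m](@prednK (q ^ m)) ?expn_gt0 ?(ltnW q_gt1) // mulnS addnC.
  by rewrite modnMDl.
(* The only possible value of a rotation that is not its own residue is q^m - 1; it would force i =
   0. *)
have := rotq_leq (ltnW km) am; rewrite leq_eqVlt => /predU1P[Ern|rn].
  move: Er; rewrite Ern modnn modn_small ?(leq_trans ia) // => i00.
  by rewrite -i00 in i0.
move: Er; rewrite !modn_small ?(leq_trans ia) // => Er.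
by move: (La k km); rewrite Er leqNgt ia.
Qed.

End Rotation.

(** * Roots of the generators and equality of codes *)

Section Code.
Local Open Scope ring_scope.
Variables (F : finFieldType) (K : fieldExtType F) (alpha : K).
Notation n := (prim_length K).
Notation q := #|F|.
Notation m := (\dim {:K}).

Lemma big_lcmp_neq0 (I : Type) (r : seq I) (f : I -> {poly F}) :
  (forall i, f i != 0) -> \big[@lcmp F/1]_(i <- r) f i != 0.
Proof.
move=> f0; elim/big_rec: _ => [|i p _ p0]; first exact: oner_neq0.
have g0 : gcdp (f i) p != 0 by rewrite gcdp_eq0 negb_and f0.
rewrite /lcmp scaler_eq0 invr_eq0 lead_coef_eq0 orbb.
by rewrite dvdp_div_eq0 ?mulf_neq0 // dvdp_mulr ?dvdp_gcdl.
Qed.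

Lemma big_lcmp_dvdp (I : eqType) (r : seq I) (f : I -> {poly F}) p :
  (forall i, f i != 0) ->
  reflect {in r, forall i, f i %| p} (\big[@lcmp F/1]_(i <- r) f i %| p).
Proof.
move=> f0; apply: (iffP idP).
  elim: r => // a r IH; rewrite big_cons dvdp_lcmp ?f0 ?big_lcmp_neq0 //.
  by move=> /andP[fa /IH fr] i; rewrite inE => /predU1P[->|/fr].
elim: r => [|a r IH] H; first by rewrite big_nil dvd1p.
rewrite big_cons dvdp_lcmp ?f0 ?big_lcmp_neq0 // H ?mem_head //=.
by apply: IH => i ir; rewrite H // inE ir orbT.
Qed.

Lemma bch_gen_dvdp d p :
  reflect (forall i, (1 <= i < d)%N -> root (map_poly (in_alg K) p) (alpha ^+ i))
          (bch_gen alpha d %| p).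
Proof.
have f0 i : minPolyF (alpha ^+ i) != 0 by exact: minPolyF_neq0.
rewrite /bch_gen. apply: (iffP (big_lcmp_dvdp _ _ f0)) => [H i id|H i].
  by rewrite -minPolyF_dvdp H // mem_index_iota.
by rewrite mem_index_iota minPolyF_dvdp; apply: H.
Qed.

Lemma bch_gen_root d i : (1 <= i < d)%N ->
  root (map_poly (in_alg K) (bch_gen alpha d)) (alpha ^+ i).
Proof. by move: i; apply/bch_gen_dvdp. Qed.

(** The lcm divides the product of the minimal polynomials, and a product vanishes only where a
    factor does. *)
Lemma root_bch_gen d y : (0 < m)%N ->
  (forall i, (1 <= i < d)%N -> (alpha ^+ i) ^+ (q ^ m) = alpha ^+ i) ->
  root (map_poly (in_alg K) (bch_gen alpha d)) y ->
  exists i k, [/\ (1 <= i < d)%N, (k < m)%N & y = alpha ^+ (i * q ^ k)].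
Proof.
move=> m0 am ry.
have : bch_gen alpha d %| \prod_(1 <= i < d) minPolyF (alpha ^+ i).
  apply/bch_gen_dvdp => i id.
  by rewrite -minPolyF_dvdp (big_rem i) ?mem_index_iota //= dvdp_mulr.
rewrite -(dvdp_map (in_alg K)) => /(dvdp_trans _) H.
move: ry; rewrite root_factor_theorem => /H; rewrite -root_factor_theorem.
rewrite rmorph_prod => /rootP/eqP; rewrite horner_prod prodf_seq_eq0 => /hasP[i].
rewrite mem_index_iota /= => id /(root_minPolyF m0 (am i id))[k km ->].
by exists i, k; rewrite exprM.
Qed.

(** Reduction modulo [h] is invisible at a root of [h], so classes modulo x^n - 1 can be evaluated
    at powers of [alpha]. *)
Lemma rmodp_horner (p h : {poly F}) (x : K) : h \is monic ->
  root (map_poly (in_alg K) h) x ->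
  (map_poly (in_alg K) (Pdiv.Ring.rmodp p h)).[x] = (map_poly (in_alg K) p).[x].
Proof.
move=> hM /rootP h0; rewrite {2}(Pdiv.RingMonic.rdivp_eq hM p).
by rewrite rmorphD rmorphM /= !hornerE h0 mulr0 add0r.
Qed.

Lemma bch_code_eq_root d e i : (0 < n)%N -> alpha ^+ n = 1 ->
  bch_code alpha d = bch_code alpha e -> (1 <= i < e)%N ->
  root (map_poly (in_alg K) (bch_gen alpha d)) (alpha ^+ i).
Proof.
move=> n0 an cde ie.
set h : {poly F} := 'X^n - 1.
(* [mk_monic] falls back to ['X] unless its argument is monic and nonconstant; [n0] excludes the
   fallback. *)
have hr : root (map_poly (in_alg K) (mk_monic h)) (alpha ^+ i).
  rewrite /mk_monic /h size_XnsubC // ltnS n0 monicXnsubC //.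
  rewrite rmorphB /= map_polyXn rmorph1 rootE !hornerE.
  by rewrite -exprM mulnC exprM an expr1n subrr.
have : in_qpoly h (bch_gen alpha d) \in bch_code alpha e.
  by rewrite -cde; apply/imsetP; exists 1; rewrite ?mul1r.
case/imsetP => c _ /(congr1 (fun p : {poly %/ _} => (map_poly (in_alg K) p).[alpha ^+ i])).
rewrite poly_of_qpolyM /= !rmodp_horner ?monic_mk_monic //.
rewrite rmorphM hornerM /= rmodp_horner ?monic_mk_monic //.
by rewrite (rootP (bch_gen_root ie)) mulr0 => /rootP.
Qed.

Lemma bch_codeS d e : bch_gen alpha d %| bch_gen alpha e ->
  bch_code alpha e \subset bch_code alpha d.
Proof.
move=> /dvdpP[p E]; apply/subsetP => _ /imsetP[c _ ->]; rewrite E.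
by apply/imsetP; exists (c * in_qpoly _ p); rewrite // rmorphM mulrA.
Qed.

Lemma bose_distanceE delta D : (0 < m)%N -> n.-primitive_root alpha ->
  (2 <= delta <= D)%N -> (D <= n)%N -> coset_leader q m D ->
  (forall d, (delta <= d < D)%N -> exists2 t, (t < m)%N & (rotq q m t d < d)%N) ->
  bose_distance alpha delta = D.
Proof.
move=> m0 prim /andP[d2 dD] Dn LD Hd; have q1 := finNzRing_gt1 F.
have an := prim_expr_order prim; have n0 := prim_order_gt0 prim.
(* Strong induction: from [delta] on, some rotation of [d] is smaller, and Frobenius carries the
   root with that exponent back to alpha^d. *)
have DG d : (0 < d < D)%N ->
    root (map_poly (in_alg K) (bch_gen alpha delta)) (alpha ^+ d).
  elim/ltn_ind: d => d IH /andP[d0 dlt].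
  have [ddl|ddg] := ltnP d delta; first by rewrite bch_gen_root // d0.
  have [|t tm rt] := Hd d; first by rewrite ddg.
  have /IH : (rotq q m t d < d)%N by [].
  rewrite rotq_gt0 // (ltn_trans rt) // => /(_ isT)/(root_iter_frob t).
  by rewrite -exprM -(prim_expr_mod prim) rotqK ?(ltnW tm) // prim_expr_mod.
have cE : bch_code alpha delta = bch_code alpha D.
  apply/eqP; rewrite eqEsubset !bch_codeS //; last by apply/bch_gen_dvdp.
  by apply/bch_gen_dvdp => i /andP[i0 id]; rewrite bch_gen_root // i0 (leq_trans id).
apply/eqP; rewrite eqn_leq; apply/andP; split; last first.
  by apply: leq_bigmax_seq; rewrite ?mem_index_iota ?(leq_trans d2) //= cE.
apply/bigmax_leqP_seq => d; rewrite mem_index_iota => /andP[_ dn] /eqP cd.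
rewrite leqNgt; apply/negP => Dd.
have D0 : (0 < D)%N by rewrite (leq_trans _ dD) // ltnW.
(* Equal codes for some [d > D] would make alpha^D a root of the generator for [D], hence a
   conjugate of some alpha^i with [i < D], against [D] being a leader. *)
have : root (map_poly (in_alg K) (bch_gen alpha D)) (alpha ^+ D).
  by apply: (bch_code_eq_root n0 an (e := d)); rewrite -?cE // D0.
case/root_bch_gen => // [i _|i [k [iD km]]].
  rewrite -exprM -(prim_expr_mod prim) -(@prednK (q ^ m)%N) ?expn_gt0 ?(ltnW q1) //.
  by rewrite mulnS addnC modnMDl prim_expr_mod.
move/eqP; rewrite (eq_prim_root_expr prim) => /eqP.
by apply: coset_leader_min => //; rewrite -(@prednK (q ^ m)%N) ?expn_gt0 ?(ltnW q1).
Qed.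

End Code.

(** * Digit sums as quotients and remainders *)

Section Digits.
Variables (q N : nat) (dg : nat -> nat).
Hypothesis dg_lt : forall l, l < N -> dg l < q.

Lemma sum_digits_lt k : k <= N -> \sum_(0 <= l < k) dg l * q ^ l < q ^ k.
Proof.
elim: k => [|k IH] kN; first by rewrite big_geq.
rewrite big_nat_recr //= expnS; have := IH (ltnW kN); have := dg_lt kN; nia.
Qed.

Lemma sum_digits_cat k : k <= N -> \sum_(0 <= l < N) dg l * q ^ l =
  (\sum_(k <= l < N) dg l * q ^ (l - k)) * q ^ k + \sum_(0 <= l < k) dg l * q ^ l.
Proof.
move=> kN; rewrite (big_cat_nat (n := k)) //= addnC big_distrl; congr (_ + _).
by apply: eq_big_nat => l /andP[kl _]; rewrite /= -mulnA -expnD subnK.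
Qed.

Lemma sum_digits_div k : k <= N -> (\sum_(0 <= l < N) dg l * q ^ l) %/ q ^ k =
  \sum_(k <= l < N) dg l * q ^ (l - k).
Proof.
move=> kN; have := sum_digits_lt kN; rewrite (sum_digits_cat kN) => lt.
by rewrite divnMDl ?(leq_ltn_trans _ lt) // divn_small ?addn0.
Qed.

Lemma sum_digits_mod k : k <= N -> (\sum_(0 <= l < N) dg l * q ^ l) %% q ^ k =
  \sum_(0 <= l < k) dg l * q ^ l.
Proof.
by move=> kN; rewrite (sum_digits_cat kN) modnMDl modn_small // sum_digits_lt.
Qed.

Lemma sum_digits_nth k : k < N ->
  (\sum_(0 <= l < N) dg l * q ^ l) %/ q ^ k = dg k %[mod q].
Proof.
move=> kN; rewrite sum_digits_div ?(ltnW kN) // big_ltn // subnn muln1 addnC.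
rewrite (eq_big_nat _ _ (F2 := fun l => dg l * q ^ (l - k.+1) * q)).
  by rewrite -big_distrl modnMDl.
by move=> l /andP[kl _]; rewrite -mulnA -expnSr subnSK.
Qed.

End Digits.

(** * Comparing an integer with its rotations *)

Section LeaderCriterion.
Variables (q h j A a : nat).
Notation m := h.*2.+1.
Hypotheses (q_gt1 : 1 < q) (jh : 3 * j <= h.+1) (A_bnd : h - j < A <= h + j).
Hypotheses (a_lt : a < q ^ (h + j).+1) (low_lt : a %% q ^ A < q ^ (h - j).+1)
  (q_ndvd : ~~ (q %| a %/ q ^ A)).

Let q0 k : 0 < q ^ k. Proof. by rewrite expn_gt0 ltnW. Qed.

Let leqX k l : k <= l -> q ^ k <= q ^ l.
Proof. by move=> kl; rewrite leq_exp2l. Qed.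

Let high_lt k : k <= (h + j).+1 -> a %/ q ^ k < q ^ ((h + j).+1 - k).
Proof. by move=> kh; rewrite ltn_divLR // -expnD subnK. Qed.

Lemma rotq1_lt : 0 < a -> q %| a -> rotq q m 1 a < a.
Proof.
move=> a0 qa; rewrite /rotq expn1 (eqP qa) mul0n add0n ltn_Pdiv //.
Qed.

(** Cut at position m - A: the rotation is L followed by H < q^(m - A), and [a] is U followed by its
    lower digits, so L < U settles the comparison. *)
Lemma rotq_lt : ~~ (q %| a) -> a %% q ^ A <= a %/ q ^ (m - A) -> rotq q m A a < a.
Proof.
move=> qa; set B := m - A; set U := a %/ q ^ B; rewrite leq_eqVlt /rotq -/B.
have HB : a %/ q ^ A < q ^ B.
  by apply: leq_trans (high_lt _) (leqX _); rewrite /B; lia.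
have aE : a = U * q ^ B + a %% q ^ B by exact: divn_eq.
case/predU1P => [LU | ltLU]; last by move: HB ltLU; rewrite {5}aE; nia.
(* In the tie L = U the remaining digits decide: for A <= h the digit of a at
   position A beats H, and for A > h the tie would make q divide a. *)
rewrite LU {2}aE ltn_add2l.
have [Ah | hA] := leqP A h.
  (* [jh] and [h - j < A] give h + j + 1 - A <= A, hence H < q^A; the nonzero digit at [A < B] makes
     the other side at least q^A. *)
  apply: leq_trans (high_lt _) (leq_trans (leqX _) (_ : q ^ A <= _)); try lia.
  rewrite leqNgt; apply: contra q_ndvd => Wlt.
  have AB : A < B by rewrite /B; lia.
  rewrite aE -{1}(subnK (ltnW AB)) expnD mulnA divnMDl //.
  by rewrite (divn_small Wlt) addn0 dvdn_mull // -(subnSK AB) expnS dvdn_mulr.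
case/negP: qa; rewrite (divn_eq a (q ^ A)) dvdn_add //.
  by rewrite dvdn_mull // -(ltn_predK hA) expnS dvdn_mulr.
have BA : B < A by rewrite /B; lia.
rewrite LU /U {1}(divn_eq a (q ^ A)) -{2}(subnK (ltnW BA)) expnD mulnA divnMDl //.
rewrite [(a %% _) %/ _]divn_small; last first.
  by apply: leq_trans low_lt (leqX _); rewrite /B; lia.
by rewrite addn0 dvdn_mull // -(subnSK BA) expnS dvdn_mulr.
Qed.

Lemma coset_leader_high_low :
  ~~ (q %| a) -> a %/ q ^ (m - A) < a %% q ^ A -> coset_leader q m a.
Proof.
move=> qa ltUL [|t] tm; first by rewrite /rotq expn0 modn1 divn1.
(* Shifts beyond h + j bring all of [a] to the front. *)
have [ht | th] := leqP (h + j) t.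
  by rewrite /rotq modn_small ?(leq_trans a_lt) ?leqX //
    (leq_trans (leq_pmulr a (q0 (m - t.+1)))) ?leq_addr.
(* The other shifts only need a lower bound [k] on the digits moved to the front. It comes from the
   nonzero last digit, then from L > U, then from the nonzero digit at [A]. *)
have big k : k <= a %% q ^ t.+1 -> a <= k * q ^ (m - t.+1) -> a <= rotq q m t.+1 a.
  move=> k1 /leq_trans; apply; rewrite /rotq (leq_trans (leq_mul k1 (leqnn _))) //.
  exact: leq_addr.
have [tj | jt] := leqP t.+1 (h - j).
  apply: (big 1); last by rewrite mul1n (leq_trans (ltnW a_lt)) ?leqX //; lia.
  rewrite lt0n; apply: contra qa => /(dvdn_trans _); apply.
  by rewrite expnS dvdn_mulr.
have [tA | At] := leqP t.+1 A.
  apply: (big (a %/ q ^ (m - A)).+1).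
    have -> : a %% q ^ t.+1 = a %% q ^ A; last by [].
    rewrite -(modn_dvdm a (dvdn_exp2l q tA)) modn_small //.
    exact: leq_trans low_lt (leqX _).
  apply: leq_trans (ltnW (ltn_ceil a (q0 (m - A)))) _.
  by rewrite leq_mul2l leqX ?orbT //; lia.
(* Here A >= h - j + 1 >= 2j makes A + m - (t + 1) at least h + j + 1. *)
apply: (big (q ^ A)); last first.
  by rewrite -expnD (leq_trans (ltnW a_lt)) ?leqX //; lia.
rewrite leqNgt; apply: contra q_ndvd => lt.
rewrite (divn_eq a (q ^ t.+1)) -{2}(subnK (ltnW At)) expnD mulnA divnMDl //.
by rewrite [_ %% _ %/ _]divn_small // addn0 dvdn_mull // -(subnSK At) expnS dvdn_mulr.
Qed.

End LeaderCriterion.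

Lemma divn_add_low c r s p x : x < p -> (c * (r * p) + x) %/ (p * s) = c * r %/ s.
Proof.
move=> xp; rewrite divnMA mulnA divnMDl ?(leq_ltn_trans _ xp) //.
by rewrite (divn_small xp) addn0.
Qed.

(** * The first coset leader from delta on *)

Section NextLeader.
Variables (F : finFieldType) (K : fieldExtType F) (alpha : K) (h j A delta : nat).
Notation q := #|F|.
Notation m := h.*2.+1.
Notation H := (delta %/ q ^ A).
Notation L := (delta %% q ^ A).
Notation U := (delta %/ q ^ (m - A)).
Hypotheses (dimK : \dim {:K} = m)
  (prim : (prim_length K).-primitive_root%R alpha).
Hypotheses (j_gt0 : 0 < j) (jh : 3 * j <= h.+1) (A_bnd : h - j < A <= h + j).
Hypotheses (d_ge2 : 2 <= delta) (d_lt : delta < q ^ (h + j).+1)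
  (low_lt : L < q ^ (h - j).+1) (q_ndvd : ~~ (q %| H)).

Let q_gt1 : 1 < q. Proof. exact: finNzRing_gt1. Qed.
Let q0 k : 0 < q ^ k. Proof. by rewrite expn_gt0 ltnW. Qed.
Let leqX k l : k <= l -> q ^ k <= q ^ l.
Proof. by move=> kl; rewrite leq_exp2l. Qed.

Section HighLow.
Variables (x : nat) (x_lt : x < q ^ (h - j).+1).

Let x_ltA : x < q ^ A.
Proof. by apply: leq_trans x_lt (leqX _); case/andP: A_bnd. Qed.

Lemma high_low_div : (H * q ^ A + x) %/ q ^ A = H.
Proof. by rewrite divnMDl // (divn_small x_ltA) addn0. Qed.

Lemma high_low_mod : (H * q ^ A + x) %% q ^ A = x.
Proof. by rewrite modnMDl modn_small. Qed.

(** Both [x] and [L] occupy the lowest h - j + 1 digits, and m - A >= h - j + 1, so the quotient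
    drops them and depends on [H] only. *)
Lemma high_low_div_compl : (H * q ^ A + x) %/ q ^ (m - A) = U.
Proof.
have hjB : (h - j).+1 <= m - A by move: A_bnd jh; clear; lia.
have /andP[hjA _] := A_bnd.
rewrite {2}(divn_eq delta (q ^ A)) -(subnKC hjB) -{2 5}(subnK hjA) !expnD.
by rewrite !divn_add_low.
Qed.

Lemma high_low_lt : H * q ^ A + x < q ^ (h + j).+1.
Proof.
have /andP[_ Ahj] := A_bnd.
have : H < q ^ ((h + j).+1 - A) by rewrite ltn_divLR // -expnD subnK // leqW.
rewrite -(leq_pmul2r (q0 A)) -expnD subnK ?(leqW Ahj) //; apply: leq_trans.
by rewrite mulSn addnC ltn_add2r.
Qed.

Lemma high_low_dvd : (q %| H * q ^ A + x) = (q %| x).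
Proof.
have /andP[hjA _] := A_bnd.
by rewrite dvdn_addr // dvdn_mull // -(ltn_predK hjA) expnS dvdn_mulr.
Qed.

End HighLow.

(** With [H] and [U] fixed, the search runs over low parts only: a multiple of q is beaten by the
    shift by one digit, a low part at most [U] by the shift by [A]. *)
Lemma bose_distance_high_low x : x < q ^ (h - j).+1 -> L <= x -> ~~ (q %| x) -> U < x ->
  (forall y, L <= y < x -> (q %| y) || (y <= U)) ->
  bose_distance alpha delta = H * q ^ A + x.
Proof.
move=> x_lt Lx qx Ux small.
have Hlt := high_low_lt x_lt; have Hlow := high_low_mod x_lt; have HU := high_low_div_compl x_lt.
have Hd := high_low_dvd x.
apply: bose_distanceE; rewrite ?dimK //.
- by rewrite d_ge2 /= {1}(divn_eq delta (q ^ A)) leq_add2l.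
- rewrite /prim_length dimK -ltnS prednK // (leq_trans Hlt) // leqX //; move: jh; clear; lia.
- apply: (@coset_leader_high_low q h j A); rewrite ?high_low_div ?Hlow ?HU ?Hd //.
move=> d /andP[dd dx]; have [y yE] : exists y, d = H * q ^ A + y.
  exists (d - H * q ^ A); rewrite subnKC // (leq_trans _ dd) //.
  by rewrite {2}(divn_eq delta (q ^ A)) leq_addr.
have yx : y < x by move: dx; rewrite yE ltn_add2l.
have Ly : L <= y by move: dd; rewrite yE {1}(divn_eq delta (q ^ A)) leq_add2l.
move: small => /(_ y); rewrite Ly yx => /(_ isT).
have y_lt := ltn_trans yx x_lt.
have ltd := high_low_lt y_lt; have Ed := high_low_dvd y.
have [qy _ | qy /= yU] := boolP (q %| y).
  exists 1; first by move: jh j_gt0; clear; lia.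
  by apply: rotq1_lt => //; rewrite ?yE ?Ed // -yE (leq_trans _ dd) // ltnW.
exists A; first by move: A_bnd jh; clear; lia.
have Eh := high_low_div y_lt; have El := high_low_mod y_lt; have EU := high_low_div_compl y_lt.
by apply: (rotq_lt (j := j)); rewrite // ?yE ?Eh ?El ?EU ?Ed.
Qed.

(** Leaves room for adding 1 or 2 to [U] within h - j + 1 digits. For A <= h, [U] has at most j <= h
    - j digits. For A > h, [L] lies below position m - A, so U = H q^(2A - m), with at most 2j <= h
    - j + 1 digits. *)
Lemma U_bound : (q %| U) && (U < q ^ (h - j).+1) || (U < q ^ (h - j)).
Proof.
have /andP[hjA Ahj] := A_bnd.
have Ult : U < q ^ ((h + j).+1 - (m - A)).
  by rewrite ltn_divLR // -expnD subnK //; move: A_bnd; clear; lia.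
have [Ah | hA] := leqP A h.
  apply/orP; right; apply: leq_trans Ult (leqX _).
  by move: A_bnd jh Ah; clear; lia.
apply/orP; left; apply/andP; split; last first.
  by apply: leq_trans Ult (leqX _); move: A_bnd jh hA; clear; lia.
have BA : m - A < A by move: hA; clear; lia.
rewrite (divn_eq delta (q ^ A)) -{2}(subnK (ltnW BA)) expnD.
rewrite -[X in _ %/ X]muln1 divn_add_low; last first.
  by apply: leq_trans low_lt (leqX _); move: A_bnd jh; clear; lia.
by rewrite divn1 dvdn_mull // -(subnSK BA) expnS dvdn_mulr.
Qed.

Lemma U_succ_lt : U.+1 < q ^ (h - j).+1.
Proof.
have qk := q0 (h - j); case/orP: U_bound => [/andP[qU lt]|]; last by rewrite expnS; nia.
rewrite ltn_neqAle lt andbT; apply: contraTneq q_gt1 => E.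
have : q %| U.+1 by rewrite E expnS dvdn_mulr.
by rewrite -addn1 dvdn_addr // dvdn1 => /eqP->.
Qed.

Lemma U_succ2_lt : q %| U.+1 -> U.+2 < q ^ (h - j).+1.
Proof.
move=> qU1.
case/orP: U_bound => [/andP[qU _]|].
  by move: qU1 q_gt1; rewrite -addn1 dvdn_addr // dvdn1 => /eqP->.
have : q <= q ^ (h - j) by rewrite -{1}[q]expn1 leqX //; move: jh j_gt0; clear; lia.
move=> qQ UQ; rewrite expnS (leq_trans (_ : _ <= 2 * q ^ (h - j))) ?leq_mul2r ?q_gt1 ?orbT //.
by move: (leq_trans q_gt1 qQ) UQ; clear; lia.
Qed.

Lemma delta_dvd : (q %| delta) = (q %| L).
Proof. by rewrite {1}(divn_eq delta (q ^ A)) high_low_dvd. Qed.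

Lemma bose_distance_leader :
  ~~ (q %| delta) -> U < L -> bose_distance alpha delta = delta.
Proof.
rewrite delta_dvd => qL UL; rewrite (bose_distance_high_low low_lt) -?divn_eq // => y.
by case/andP=> Ly /(leq_ltn_trans Ly); rewrite ltnn.
Qed.

(** At L = U the successor of [L] already exceeds [U], so equality belongs here; q dividing [L]
    excludes a carry out of the low digits. *)
Lemma bose_distance_dvd : q %| delta -> U <= L -> bose_distance alpha delta = delta + 1.
Proof.
rewrite delta_dvd => qL UL; rewrite (@bose_distance_high_low L.+1) //.
- by rewrite addnS -divn_eq addn1.
- rewrite ltn_neqAle low_lt andbT; apply: contraTneq q_gt1 => E.
  have : q %| L.+1 by rewrite E expnS dvdn_mulr.
  by rewrite -addn1 dvdn_addr // dvdn1 => /eqP->.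
- by rewrite -addn1 dvdn_addr // dvdn1 neq_ltn q_gt1 orbT.
by move=> y; rewrite ltnS -eqn_leq => /eqP <-; rewrite qL.
Qed.

(** The first low part above [U] is U + 1; if q divides it, then U + 2 comes next and is not a
    multiple of q. *)
Lemma bose_distance_above : L <= U ->
  bose_distance alpha delta = H * q ^ A + U + (if q %| U.+1 then 2 else 1).
Proof.
move=> LU; case: ifP => [qU | /negbT qU]; last first.
  rewrite (bose_distance_high_low U_succ_lt) ?(leqW LU) // ?addnA ?addn1 ?addnS //.
  by move=> y /andP[_ yU]; rewrite -ltnS yU orbT.
rewrite (bose_distance_high_low (U_succ2_lt qU)) ?(leqW (leqW LU)) ?addn2 ?addnS //.
  by rewrite -addn1 dvdn_addr // dvdn1 neq_ltn q_gt1 orbT.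
by move=> y /andP[_]; rewrite ltnS leq_eqVlt ltnS => /predU1P[->|->]; rewrite ?qU ?orbT.
Qed.

End NextLeader.

(** * From the digits of delta to quotients and remainders *)

Theorem theorem6 (q m : nat) (F : finFieldType) (K : fieldExtType F)
    (alpha : K) (h delta j : nat) (dg : nat -> nat) (r : int)
    (L U deltahat : nat)
  (cardF : #|F| = q) (dimK : \dim {:K} = m)
  (alpha_prim : ((q ^ m - 1)%N.-primitive_root alpha)%R)
  (m_ge5 : 5 <= m) (m_odd : odd m)
  (h_def : h = m %/ 2)
  (delta_range : q ^ (h + 1) <= delta < q ^ ((2 * m - 1) %/ 3 + 1))
  (j_def : q ^ (h + j) <= delta < q ^ (h + j + 1))
  (dg_bound : forall l, l <= h + j -> dg l <= q - 1)
  (dg_expansion : delta = \sum_(0 <= l < (h + j).+1) dg l * q ^ l)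
  (r_range : (- j%:Z + 1 <= r <= j%:Z)%R)
  (r_pos : 0 < dg `|(h%:Z + r)%R|)
  (r_min : forall s : int, (- j%:Z + 1 <= s <= j%:Z)%R ->
     0 < dg `|(h%:Z + s)%R| -> (r <= s)%R)
  (L_def : L = \sum_(0 <= l < (h - j).+1) dg l * q ^ l)
  (U_def : U = \sum_(`|(h%:Z - r + 1)%R| <= l < (h + j).+1)
                 dg l * q ^ (l - `|(h%:Z - r + 1)%R|))
  (deltahat_def : deltahat =
     \sum_(`|(h%:Z + r)%R| <= l < (h + j).+1) dg l * q ^ l + U) :
  (~~ (q %| delta) ->
     bose_distance alpha delta =
       if U < L then delta
       else if dg `|(h%:Z - r + 1)%R| != q - 1 then deltahat + 1
       else deltahat + 2)
  /\
  (q %| delta ->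
     bose_distance alpha delta =
       if U <= L then delta + 1
       else if dg `|(h%:Z - r + 1)%R| != q - 1 then deltahat + 1
       else deltahat + 2).
Proof.
have q1 : 1 < q by rewrite -cardF finNzRing_gt1.
have mE : m = h.*2.+1 by rewrite h_def divn2 -[LHS]odd_double_half m_odd.
have [Ddlo Ddhi] := andP delta_range; have [dlo dhi] := andP j_def.
have j0 : 0 < j.
  have : q ^ (h + 1) < q ^ (h + j + 1) by apply: leq_ltn_trans Ddlo dhi.
  by rewrite ltn_exp2l //; clear; lia.
(* As m = 2h + 1, the range of [delta] gives h + j <= (4h + 1)/3. *)
have jh : 3 * j <= h.+1.
  have : q ^ (h + j) < q ^ ((2 * m - 1) %/ 3 + 1) by apply: leq_ltn_trans dlo Ddhi.
  by rewrite ltn_exp2l // mE; clear; lia.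
(* Both integers are positive since r lies in [-j + 1, j] and 3j <= h + 1, so the absolute values
   change nothing; moreover B = m - A. *)
set A := `|(h%:Z + r)%R|; set B := `|(h%:Z - r + 1)%R|.
have A_bnd : h - j < A <= h + j by move: r_range jh; rewrite /A; clear; lia.
have AE : B = h.*2.+1 - A by move: r_range jh; rewrite /A /B; clear; lia.
(* A nonzero digit at [l] would contradict the minimality of [r] at l - h. Hence the remainder
   modulo q^A is the shorter sum [L]. *)
have dg0 l : h - j < l < A -> dg l = 0.
  move=> lA; apply/eqP; rewrite -leqn0 leqNgt; apply/negP => dl.
  have E : `|(h%:Z + (l%:Z - h%:Z))%R| = l by clear; lia.
  have := r_min (l%:Z - h%:Z)%R; rewrite E => /(_ _ dl).
  by move: lA r_range jh; rewrite /A; clear; lia.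
have dg_lt l : l < (h + j).+1 -> dg l < q.
  by move=> lN; have := dg_bound l lN; move: q1; clear; lia.
have AN : A < (h + j).+1 by case/andP: A_bnd.
have BN : B < (h + j).+1 by rewrite AE; move: A_bnd jh; clear; lia.
have divA := sum_digits_div dg_lt (ltnW AN).
have UE : delta %/ q ^ B = U by rewrite U_def dg_expansion sum_digits_div // ltnW.
have dhE : deltahat = delta %/ q ^ A * q ^ A + U.
  rewrite deltahat_def dg_expansion divA big_distrl; congr (_ + _).
  by apply: eq_big_nat => l /andP[Al _] /=; rewrite -mulnA -expnD subnK.
have LE : delta %% q ^ A = L.
  rewrite L_def dg_expansion sum_digits_mod ?(ltnW AN) //.
  rewrite (big_cat_nat (n := (h - j).+1)) //=; last by case/andP: A_bnd.
  rewrite [X in _ + X]big_nat_cond [X in _ + X]big1 ?addn0 // => l.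
  by rewrite andbT => /dg0->.
have L_lt : L < q ^ (h - j).+1.
  by rewrite L_def (sum_digits_lt dg_lt) // ltnS; move: jh; clear; lia.
have qH : ~~ (q %| delta %/ q ^ A).
  rewrite /dvdn dg_expansion (sum_digits_nth dg_lt AN) modn_small ?dg_lt //.
  by rewrite -lt0n.
have UB : U = dg B %[mod q] by rewrite -UE dg_expansion (sum_digits_nth dg_lt BN).
(* The last digit of [U] is the one at [B], so the exceptional value q - 1 is exactly what makes U +
   1 a multiple of q. *)
have qU : (q %| U.+1) = (dg B == q - 1).
  rewrite /dvdn -addn1 -modnDml UB modnDml addn1.
  have := dg_lt B BN; rewrite leq_eqVlt => /predU1P[<-|lt].
    by rewrite modnn subn1 !eqxx.
  by rewrite modn_small //= ; move: lt; clear; lia.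
have d2 : 2 <= delta.
  apply: leq_trans (leq_trans _ Ddlo); first exact: q1.
  by rewrite -{1}[q]expn1 leq_exp2l //; clear; lia.
have dimE : \dim {:K} = h.*2.+1 by rewrite dimK.
have prim : (prim_length K).-primitive_root%R alpha.
  by rewrite /prim_length dimK cardF -subn1.
clear -cardF q1 j0 jh A_bnd AE UE dhE LE L_lt qH qU d2 dimE prim dhi.
move: dhi; rewrite addn1 => dhi.
subst q; rewrite -LE in L_lt.
have above : delta %% #|F| ^ A <= U -> bose_distance alpha delta =
    if dg B != #|F| - 1 then deltahat + 1 else deltahat + 2.
  rewrite -UE AE => LU; rewrite (bose_distance_above dimE prim j0 jh A_bnd) //.
  by rewrite -AE UE -dhE qU; case: eqP.
split=> qd.
  case: ltnP => [UL | LU]; last by apply: above; rewrite LE.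
  by apply: (bose_distance_leader dimE prim j0 jh A_bnd) => //; rewrite -AE UE LE.
case: leqP => [UL | LU]; last by apply: above; rewrite LE ltnW.
by apply: (bose_distance_dvd dimE prim j0 jh A_bnd) => //; rewrite -AE UE LE.
Qed.
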